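(* Let $A\in\mathbb{C}^{n\times n}$ be nonsingular with a multisplitting $(M_k,N_k,E_k)_{k=1}^m$ satisfying one of the following conditions: (i) $E_k=\beta_k I$ and $M_k^*A+A^*N_k=M_k^*M_k-N_k^*N_k\succ 0$ for $k=1,2,\dots,m$; (ii) $E_k=\beta_k I$ and $\|M_k^{-1}N_k\|_2<1$ for $k=1,2,\dots,m$. Then, for every $b\in\mathbb{C}^n$, the parallel multisplitting iteration converges to the unique solution of $Ax=b$ for any choice of the initial guess $x^{(0)}\in\mathbb{C}^n$.
   Context: A multisplitting of $A\in\mathbb{C}^{n\times n}$ is a collection of triples of $n\times n$ matrices $(M_k,N_k,E_k)_{k=1}^m$ such that $A=M_k-N_k$ with $M_k$ nonsingular for $k=1,\dots,m$, and the $E_k$ are diagonal matrices with nonnegative entries satisfying $\sum_{k=1}^m E_k=I$. When $E_k=\beta_k I$, the $\beta_k$ are thus nonnegative scalars with $\sum_{k=1}^m\beta_k=1$. The parallel multisplitting iteration for $Ax=b$: given $x^{(0)}$, for $i=0,1,2,\dots$ solve $M_k y_k=N_k x^{(i)}+b$ for $k=1,\dots,m$ and set $x^{(i+1)}=\sum_{k=1}^m E_k y_k$. Equivalently $x^{(i+1)}=Tx^{(i)}+\sum_{k=1}^m E_kM_k^{-1}b$ with $T=\sum_{k=1}^m E_kM_k^{-1}N_k$. $X^*$ denotes the conjugate transpose, $X\succ0$ means $X$ is Hermitian positive definite, and $\|\cdot\|_2$ is the spectral norm. *)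

(* Defs.v *)
From HB Require Import structures.
From mathcomp Require Import all_boot all_order all_algebra.
From mathcomp Require Import all_classical all_reals all_analysis.
From mathcomp Require Import complex.

Set Implicit Arguments.
Unset Strict Implicit.
Unset Printing Implicit Defensive.

Import Order.TTheory GRing.Theory Num.Theory Num.Def.
Import numFieldNormedType.Exports.
Local Open Scope classical_set_scope.
Local Open Scope complex_scope.
Local Open Scope ring_scope.
Local Open Scope sesquilinear_scope.

(* The order on [R[i]] is partial: [0 < z] forces [z] to be a positive real. *)
Definition posdefmx (R : realType) (n : nat) (X : 'M[R[i]]_n) : Prop :=
  X \is hermsymmx /\
  forall x : 'cV[R[i]]_n, x != 0 -> 0 < (x ^t* *m X *m x) 0 0.

Definition norm2 (R : realType) (n : nat) (x : 'cV[R[i]]_n) : R :=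
  Num.sqrt (\sum_i ComplexField.Normc.normc (x i 0) ^+ 2).

(* The set is nonempty and, the dimension being finite, bounded, so that [sup]
   does not take its default value. *)
Definition spectral_norm (R : realType) (n : nat) (X : 'M[R[i]]_n) : R :=
  sup [set norm2 (X *m x) | x in [set x : 'cV[R[i]]_n | norm2 x <= 1]].

(* In the partial order on [R[i]], [0 <= E k i i] says that the entry is real
   and nonnegative. *)
Definition multisplitting (R : realType) (n m : nat) (A : 'M[R[i]]_n)
    (M N E : 'I_m -> 'M[R[i]]_n) : Prop :=
  [/\ forall k, A = M k - N k,
      forall k, M k \in unitmx,
      forall k, is_diag_mx (E k) /\ (forall i, 0 <= E k i i) &
      \sum_k E k = 1%:M].

(* When [M k] is nonsingular, [invmx (M k) *m (N k *m x + b)] is the solution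
   [y_k] of [M k *m y_k = N k *m x + b]. *)
Definition multisplitting_step (R : realType) (n m : nat)
    (M N E : 'I_m -> 'M[R[i]]_n) (b x : 'cV[R[i]]_n) : 'cV[R[i]]_n :=
  \sum_k E k *m (invmx (M k) *m (N k *m x + b)).

Definition multisplitting_iterate (R : realType) (n m : nat)
    (M N E : 'I_m -> 'M[R[i]]_n) (b x0 : 'cV[R[i]]_n) (i : nat) :
    'cV[R[i]]_n :=
  iter i (multisplitting_step M N E b) x0.

(* Main.v *)
Require Import Defs.
From HB Require Import structures.
From mathcomp Require Import all_boot all_order all_algebra.
From mathcomp Require Import all_classical all_reals all_analysis.
From mathcomp Require Import complex ring.

Set Implicit Arguments.
Unset Strict Implicit.
Unset Printing Implicit Defensive.

Import Order.TTheory GRing.Theory Num.Theory Num.Def.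
Import numFieldNormedType.Exports.
Local Open Scope classical_set_scope.
Local Open Scope complex_scope.
Local Open Scope ring_scope.
Local Open Scope sesquilinear_scope.

(** In case (ii) each [M_k^-1 N_k] strictly contracts the Euclidean norm, hence
    so does the iteration matrix [T = sum_k beta_k M_k^-1 N_k].  In case (i) it
    is [N_k M_k^-1] that contracts: [M^* M - N^* N] positive definite means
    [|N u| < |M u|] for [u != 0], uniformly by the spectral theorem.  Since
    [A = M_k - N_k], we have [A M_k^-1 N_k A^-1 = N_k M_k^-1], so [T] is similar,
    through [A], to a convex combination of contractions.  Either way the errors
    [T^i (x0 - xsol)] decay geometrically. *)

(** * Squared Euclidean norms and positive definite forms *)

Definition sqnorm (C : numClosedFieldType) (n : nat) (x : 'cV[C]_n) : C :=
  \sum_i `|x i 0| ^+ 2.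

(** [q] is the square of a Lipschitz constant, and [0 <= q] makes it real. One factor for all [x] is
    what yields a geometric rate. *)
Definition contractive (C : numClosedFieldType) (n : nat) (X : 'M[C]_n) : Prop :=
  exists q : C,
    [/\ 0 <= q, q < 1 & forall x, sqnorm (X *m x) <= q * sqnorm x].

Lemma sqnorm_ge0 (C : numClosedFieldType) n (x : 'cV[C]_n) : 0 <= sqnorm x.
Proof. by apply: sumr_ge0 => i _; rewrite exprn_ge0. Qed.

Lemma le_sqnorm (C : numClosedFieldType) n (x : 'cV[C]_n) i :
  `|x i 0| ^+ 2 <= sqnorm x.
Proof.
rewrite /sqnorm (bigD1 i) //= lerDl; apply: sumr_ge0 => j _.
by rewrite exprn_ge0.
Qed.

Lemma sqnormE (C : numClosedFieldType) n (x : 'cV[C]_n) :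
  (x^t* *m x) 0 0 = sqnorm x.
Proof.
rewrite mxE; apply: eq_bigr => i _.
by rewrite !mxE normCK mulrC.
Qed.

Lemma sqnorm_unitarymx (C : numClosedFieldType) n (U : 'M[C]_n) (x : 'cV[C]_n) :
  U \is unitarymx -> sqnorm (U *m x) = sqnorm x.
Proof.
move=> Uu; rewrite -!sqnormE trmx_mul map_mxM mulmxA -(mulmxA (x^t*)).
by rewrite -invmx_unitary // mulVmx ?unitarymx_unit // mulmx1.
Qed.

(** [X] is unitarily diagonalisable, and a positive lower bound on its eigenvalues serves as [c]. *)
Lemma hermsymmx_posdef_bound (C : numClosedFieldType) n (X : 'M[C]_n) :
  X \is hermsymmx ->
  (forall x : 'cV[C]_n, x != 0 -> 0 < (x^t* *m X *m x) 0 0) ->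
  exists2 c : C, 0 < c & forall x, c * sqnorm x <= (x^t* *m X *m x) 0 0.
Proof.
move=> /hermitian_normalmx /orthomx_spectralP XE Xpos.
set U := spectralmx X in XE; set d := spectral_diag X in XE.
have Uu : U \is unitarymx by exact: spectral_unitarymx.
have quadE x : (x^t* *m X *m x) 0 0 = \sum_i d 0 i * `|(U *m x) i 0| ^+ 2.
  rewrite XE invmx_unitary // !mulmxA -mulmxA.
  rewrite -map_mxM -trmx_mul mxE; apply: eq_bigr => i _.
  by rewrite mul_mx_diag !mxE normCK; ring.
have d_gt0 i : 0 < d 0 i.
  (* Testing the form on the [i]-th eigenvector isolates [d 0 i]. *)
  have := Xpos (invmx U *m delta_mx i 0).
  rewrite quadE mulKVmx ?unitarymx_unit // (bigD1 i) //= big1 => [|j ji].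
    rewrite mxE !eqxx normr1 expr1n mulr1 addr0; apply.
    apply/eqP => /(congr1 (mulmx U)).
    rewrite mulKVmx ?unitarymx_unit // mulmx0 => /matrixP/(_ i 0).
    by rewrite !mxE !eqxx => /eqP; rewrite oner_eq0.
  by rewrite mxE (negPf ji) /= normr0 expr0n mulr0.
(* The inverse of this quantity is below every [d 0 i]; the added 1 keeps it positive when
   [n = 0]. *)
have s_gt0 : 0 < 1 + \sum_i (d 0 i)^-1.
  by rewrite ltr_pwDl // sumr_ge0 // => i _; rewrite invr_ge0 ltW.
exists (1 + \sum_i (d 0 i)^-1)^-1; first by rewrite invr_gt0.
move=> x; rewrite quadE -(sqnorm_unitarymx x Uu) /sqnorm mulr_sumr.
apply: ler_sum => i _; rewrite ler_wpM2r ?exprn_ge0 //.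
rewrite -[leRHS]invrK lef_pV2 ?posrE ?invr_gt0 //.
rewrite (bigD1 i) //= addrCA lerDl addr_ge0 // sumr_ge0 // => j _.
by rewrite invr_ge0 ltW.
Qed.

(* [sum_k beta_k |z_k|^2 - |s|^2 = sum_k beta_k |z_k - s|^2] for the mean [s]. *)
Lemma sqr_norm_convex (C : numClosedFieldType) (I : finType) (beta z : I -> C) :
  (forall k, 0 <= beta k) -> \sum_k beta k = 1 ->
  `|\sum_k beta k * z k| ^+ 2 <= \sum_k beta k * `|z k| ^+ 2.
Proof.
move=> beta_ge0 beta1; set s := \sum_k _ * z k.
have sJ : s^* = \sum_k beta k * (z k)^*.
  rewrite rmorph_sum; apply: eq_bigr => k _.
  by rewrite rmorphM /= (CrealP _) // ger0_real.
rewrite -subr_ge0.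
suff -> : \sum_k beta k * `|z k| ^+ 2 - `|s| ^+ 2
        = \sum_k beta k * `|z k - s| ^+ 2.
  by apply: sumr_ge0 => k _; rewrite mulr_ge0 // exprn_ge0.
have -> : \sum_k beta k * `|z k - s| ^+ 2
   = \sum_k (beta k * `|z k| ^+ 2 - s^* * (beta k * z k)
             - s * (beta k * (z k)^*) + beta k * (s * s^*)).
  by apply: eq_bigr => k _; rewrite !normCK rmorphB /=; ring.
rewrite big_split /= !sumrB -!mulr_sumr -mulr_suml beta1 -sJ -/s normCK.
by ring.
Qed.

Lemma sqnorm_convex (C : numClosedFieldType) (I : finType) n (beta : I -> C)
    (z : I -> 'cV[C]_n) :
  (forall k, 0 <= beta k) -> \sum_k beta k = 1 ->
  sqnorm (\sum_k beta k *: z k) <= \sum_k beta k * sqnorm (z k).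
Proof.
move=> beta_ge0 beta1.
under [leRHS]eq_bigr do rewrite mulr_sumr.
rewrite exchange_big /=; apply: ler_sum => i _.
rewrite summxE (eq_bigr (fun k => beta k * z k i 0)) => [|k _]; last first.
  by rewrite mxE.
exact: sqr_norm_convex.
Qed.

(** Each entry of [X *m x] is at most an absolute row sum of [X] times the norm of [x]; adding 1
    gives [0 < K] even for [X = 0]. *)
Lemma sqnorm_mulmx_bound (C : numClosedFieldType) n (X : 'M[C]_n) :
  exists2 K : C, 0 < K & forall x, sqnorm (X *m x) <= K * sqnorm x.
Proof.
exists (1 + \sum_i (\sum_j `|X i j|) ^+ 2).
  by rewrite ltr_pwDl // sumr_ge0 // => i _; rewrite exprn_ge0 // sumr_ge0.
move=> x; rewrite mulrDl mul1r -[leLHS]add0r lerD ?sqnorm_ge0 //.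
rewrite mulr_suml; apply: ler_sum => i _.
rewrite -[sqnorm x]sqrtCK -exprMn lerXn2r ?nnegrE //.
  by rewrite mulr_ge0 ?sumr_ge0 // sqrtC_ge0 sqnorm_ge0.
rewrite mxE mulr_suml (le_trans (ler_norm_sum _ _ _)) // ler_sum // => j _.
rewrite normrM ler_wpM2l // -ler_sqr ?nnegrE ?sqrtC_ge0 ?sqnorm_ge0 //.
by rewrite sqrtCK le_sqnorm.
Qed.

(** * Contractive matrices *)

Lemma contractive_convex (C : numClosedFieldType) (I : finType) n
    (beta : I -> C) (X : I -> 'M[C]_n) :
  (forall k, 0 <= beta k) -> \sum_k beta k = 1 ->
  (forall k, contractive (X k)) -> contractive (\sum_k beta k *: X k).
Proof.
move=> beta_ge0 beta1 /choice[q qP].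
have bq_ge0 k : 0 <= beta k * (1 - q k).
  by case: (qP k) => _ q1 _; rewrite mulr_ge0 // subr_ge0 ltW.
exists (\sum_k beta k * q k); split.
- by apply: sumr_ge0 => k _; case: (qP k) => q0 _ _; rewrite mulr_ge0.
(* The gap to 1 is the sum of the [beta k * (1 - q k)]; were it zero, every [beta k] would vanish,
   against their sum being 1. *)
- rewrite -subr_gt0 -beta1 -sumrB.
  under eq_bigr do rewrite -[X in X - _]mulr1 -mulrBr.
  rewrite lt_def sumr_ge0 ?andbT //; apply/negP => /eqP.
  move/eqP; rewrite psumr_eq0 // => /allP b0.
  suff : \sum_k beta k = 0 by rewrite beta1 => /eqP; rewrite oner_eq0.
  apply: big1 => k _; have := b0 k (mem_index_enum k).
  case: (qP k) => _ q1 _.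
  by rewrite /= mulf_eq0 subr_eq0 [1 == _]gt_eqF // orbF => /eqP.
- move=> x; rewrite mulmx_suml; under eq_bigr do rewrite -scalemxAl.
  rewrite (le_trans (sqnorm_convex _ beta_ge0 beta1)) // mulr_suml.
  apply: ler_sum => k _; rewrite -mulrA ler_wpM2l //.
  by case: (qP k).
Qed.

(** Write [y = M x]. Then [|N x|^2 <= |M x|^2 - c |x|^2] while [|M x|^2 <= K |x|^2], so a fixed
    fraction of [|y|^2] is lost. *)
Lemma contractive_mulmx_invmx (C : numClosedFieldType) n (M N : 'M[C]_n) :
  M \in unitmx ->
  M^t* *m M - N^t* *m N \is hermsymmx ->
  (forall x : 'cV[C]_n, x != 0 ->
     0 < (x^t* *m (M^t* *m M - N^t* *m N) *m x) 0 0) ->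
  contractive (N *m invmx M).
Proof.
move=> uM Hh /(hermsymmx_posdef_bound Hh)[c c_gt0 cP].
have [K K_gt0 KP] := sqnorm_mulmx_bound M.
have Kc_gt0 : 0 < K + c by rewrite addr_gt0.
(* A factor above the natural [1 - c / K], and nonnegative without comparing [c] and [K]. *)
exists (K / (K + c)); split.
- by rewrite divr_ge0 // ltW.
- by rewrite ltr_pdivrMr // mul1r ltrDl.
move=> y; rewrite -mulmxA; set x := invmx M *m y.
have -> : y = M *m x by rewrite mulKVmx.
have := cP x; have := KP x.
have -> : (x^t* *m (M^t* *m M - N^t* *m N) *m x) 0 0
   = sqnorm (M *m x) - sqnorm (N *m x).
  rewrite -!sqnormE !trmx_mul !map_mxM mulmxBr mulmxBl !mulmxA.
  by rewrite [LHS]mxE [X in _ + X]mxE.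
move: (sqnorm (M *m x)) (sqnorm (N *m x)) (sqnorm_ge0 x) => b a.
move: (sqnorm x) => s s_ge0 bK cs.
rewrite mulrAC ler_pdivlMr // mulrC.
apply: (@le_trans _ _ ((K + c) * (b - c * s))).
  by rewrite ler_pM2l // lerBrDl -lerBrDr.
rewrite -subr_ge0.
have -> : K * b - (K + c) * (b - c * s) = c * (K * s - b) + c * c * s by ring.
by rewrite addr_ge0 ?mulr_ge0 ?subr_ge0 // ltW.
Qed.

(** * Geometric decay and convergence *)

(** Balls of the product topology are entrywise, and [sqnorm] dominates each squared entry. *)
Lemma cvg_sqnorm_geometric (R : realType) n (u : nat -> 'cV[R[i]]_n)
    (l : 'cV[R[i]]_n) (q D : R[i]) :
  0 <= q -> q < 1 -> (forall i, sqnorm (u i - l) <= q ^+ i * D) ->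
  u @ \oo --> (l : 'cV[R[i]^o]_n).
Proof.
move=> q_ge0 q_lt1 uP.
have D_ge0 : 0 <= D.
  by have := uP 0; rewrite mul1r; apply: le_trans; exact: sqnorm_ge0.
(* Nonnegative elements of [R[i]] are real, so the geometric limit can be taken in [R]. *)
have [r qE] : exists r : R, q = r%:C.
  by exists (complex.Re q); rewrite RRe_real // ger0_real.
have [d DE] : exists d : R, D = d%:C.
  by exists (complex.Re D); rewrite RRe_real // ger0_real.
rewrite {}qE {}DE in uP q_ge0 q_lt1 D_ge0.
rewrite ler0c in q_ge0; rewrite ltcR in q_lt1; rewrite ler0c in D_ge0.
apply/(@cvg_ballP R[i] ('cV[R[i]^o]_n)) => eps eps_gt0.
have [e epsE] : exists e : R, eps = e%:C.
  by exists (complex.Re eps); rewrite RRe_real // ger0_real // ltW.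
rewrite {}epsE in eps_gt0 *.
rewrite ltcR in eps_gt0.
have cv : (fun i => r ^+ i * d) @ \oo --> (0 : R).
  rewrite -[0](mul0r d); apply: cvgMl; apply: cvg_expr.
  by rewrite ger0_norm.
have e2 : 0 < e ^+ 2 by rewrite exprn_gt0.
have : \forall k \near \oo, r ^+ k * d < e ^+ 2 by exact: cvgr_lt cv _ e2.
apply: filterS => k rk; split=> [|i j]; first by rewrite ltcR.
rewrite (ord1 j) /ball /=.
rewrite -ltr_sqr ?nnegrE ?normr_ge0 ?ler0c ?(ltW eps_gt0) //.
apply: (@le_lt_trans _ _ (sqnorm (u k - l))).
  by rewrite distrC; have := le_sqnorm (u k - l) i; rewrite !mxE.
apply: (le_lt_trans (uP k)).
by rewrite -!rmorphXn -rmorphM ltcR.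
Qed.

(** * The spectral norm *)

Lemma sqnorm_norm2 (R : realType) n (x : 'cV[R[i]]_n) :
  sqnorm x = (norm2 x ^+ 2)%:C.
Proof.
rewrite /norm2 sqr_sqrtr; last by apply: sumr_ge0 => i _; rewrite sqr_ge0.
by rewrite rmorph_sum; apply: eq_bigr => i _; rewrite rmorphXn.
Qed.

Lemma norm2_ge0 (R : realType) n (x : 'cV[R[i]]_n) : 0 <= norm2 x.
Proof. exact: sqrtr_ge0. Qed.

(** Makes [sup] a genuine upper bound: the zero vector provides a member, [sqnorm_mulmx_bound] a
    bound. *)
Lemma has_sup_spectral_norm (R : realType) n (X : 'M[R[i]]_n) :
  has_sup [set norm2 (X *m x) | x in [set x : 'cV[R[i]]_n | norm2 x <= 1]].
Proof.
split.
  exists (norm2 (X *m 0)), 0 => //=.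
  rewrite /norm2 big1 ?sqrtr0 // => i _.
  by rewrite mxE ComplexField.Normc.normc0 expr0n.
have [K K_gt0 KP] := sqnorm_mulmx_bound X.
exists (Num.sqrt (complex.Re K)) => _ [x /= x1 <-].
have KE : K = (complex.Re K)%:C by rewrite RRe_real // gtr0_real.
have ReK_ge0 : 0 <= complex.Re K by rewrite -ler0c -KE ltW.
rewrite -ler_sqr ?nnegrE ?norm2_ge0 ?sqrtr_ge0 // (sqr_sqrtr ReK_ge0).
rewrite -lecR -sqnorm_norm2 -KE (le_trans (KP x)) // sqnorm_norm2.
rewrite ger_pMr // -[1]/(1%:C) lecR.
by rewrite -[1](expr1n _ 2) ler_sqr ?nnegrE ?norm2_ge0.
Qed.

Lemma norm2Z (R : realType) n (a : R) (x : 'cV[R[i]]_n) :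
  0 <= a -> norm2 (a%:C *: x) = a * norm2 x.
Proof.
move=> a_ge0; apply/eqP.
rewrite -(@eqrXn2 _ 2) ?norm2_ge0 ?mulr_ge0 ?norm2_ge0 //.
apply/eqP/(@complexI R); rewrite [(a * _) ^+ 2]exprMn [RHS]rmorphM /=.
rewrite -!sqnorm_norm2 /sqnorm mulr_sumr; apply: eq_bigr => i _.
by rewrite mxE normrM exprMn ger0_norm ?ler0c // rmorphXn.
Qed.

(** By homogeneity it suffices to treat [x / |x|], which lies in the unit ball. *)
Lemma le_spectral_norm (R : realType) n (X : 'M[R[i]]_n) (x : 'cV[R[i]]_n) :
  norm2 (X *m x) <= spectral_norm X * norm2 x.
Proof.
have supX := has_sup_spectral_norm X.
have [x0|x0] := eqVneq (norm2 x) 0.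
  (* A vector of norm 0 cannot be normalised; the crude bound shows that its image has norm 0. *)
  have [K K_gt0 /(_ x)] := sqnorm_mulmx_bound X.
  rewrite !sqnorm_norm2 x0 expr0n !mulr0 lecR.
  by rewrite exprn_even_le0 //= => /eqP ->.
have x_gt0 : 0 < norm2 x by rewrite lt_def x0 norm2_ge0.
rewrite -ler_pdivrMr // mulrC -norm2Z ?invr_ge0 ?norm2_ge0 //.
apply: sup_upper_bound => //; exists ((norm2 x)^-1%:C *: x).
  by rewrite /= norm2Z ?invr_ge0 ?norm2_ge0 // mulVf.
by rewrite scalemxAr.
Qed.

Lemma spectral_norm_ge0 (R : realType) n (X : 'M[R[i]]_n) : 0 <= spectral_norm X.
Proof.
have supX := has_sup_spectral_norm X.
have [[_ [x x1 _]] _] := supX.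
apply: (le_trans (norm2_ge0 (X *m x))).
by apply: sup_upper_bound => //; exists x.
Qed.

Lemma contractive_spectral_norm (R : realType) n (X : 'M[R[i]]_n) :
  spectral_norm X < 1 -> contractive X.
Proof.
move=> X1; exists ((spectral_norm X) ^+ 2)%:C; split.
- by rewrite ler0c sqr_ge0.
- by rewrite -[1]/(1%:C) ltcR expr_lt1 ?spectral_norm_ge0.
move=> x; rewrite !sqnorm_norm2 -rmorphM lecR -exprMn.
rewrite ler_sqr ?nnegrE ?mulr_ge0 ?norm2_ge0 ?spectral_norm_ge0 //.
exact: le_spectral_norm.
Qed.

(** * Convergence of the iteration *)

(** The errors mapped by [P] are multiplied by [Y] at each step, so they decay like [q ^+ i];
    boundedness of [invmx P] transfers this to the errors. *)
Lemma cvg_iter_similar_contractive (R : realType) n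
    (f : 'cV[R[i]]_n -> 'cV[R[i]]_n) (P T Y : 'M[R[i]]_n) (l x0 : 'cV[R[i]]_n) :
  P \in unitmx -> contractive Y -> P *m T = Y *m P ->
  (forall x, f x - l = T *m (x - l)) ->
  (fun i => iter i f x0) @ \oo --> (l : 'cV[R[i]^o]_n).
Proof.
move=> Pu [q [q_ge0 q_lt1 qP]] PT fl.
have [K K_gt0 KP] := sqnorm_mulmx_bound (invmx P).
apply: (cvg_sqnorm_geometric (D := K * sqnorm (P *m (x0 - l))) q_ge0 q_lt1) => i.
rewrite -[X in sqnorm X](mulKmx Pu) (le_trans (KP _)) // mulrCA ler_pM2l //.
elim: i => [|i IHi]; first by rewrite mul1r.
rewrite iterS fl mulmxA PT -mulmxA exprS -mulrA.
by rewrite (le_trans (qP _)) // ler_wpM2l.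
Qed.

(* [R[i]^o] is [R[i]] with the topology of its absolute value; [-->] is
   convergence in the resulting product topology on column vectors. *)
Theorem theorem3p1 (R : realType) (n m : nat) (A : 'M[R[i]]_n)
    (M N E : 'I_m -> 'M[R[i]]_n)
    (A_unit : A \in unitmx)
    (splitA : multisplitting A M N E)
    (cond :
      (exists beta : 'I_m -> R[i], forall k,
         [/\ E k = (beta k)%:M,
             (M k)^t* *m A + A^t* *m N k
               = (M k)^t* *m M k - (N k)^t* *m N k &
             posdefmx ((M k)^t* *m M k - (N k)^t* *m N k)])
      \/
      (exists beta : 'I_m -> R[i], forall k,
         E k = (beta k)%:M /\ spectral_norm (invmx (M k) *m N k) < 1)) :
  forall b : 'cV[R[i]]_n,
  exists xsol : 'cV[R[i]]_n,
    [/\ A *m xsol = b,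
        forall z : 'cV[R[i]]_n, A *m z = b -> z = xsol &
        forall x0 : 'cV[R[i]]_n,
          multisplitting_iterate M N E b x0 @ \oo --> (xsol : 'cV[R[i]^o]_n)].
Proof.
move=> b; exists (invmx A *m b); split; first by rewrite mulKVmx.
  by move=> z <-; rewrite mulKmx.
set xsol := invmx A *m b => x0.
have [AMN Mu Ediag E1] := splitA.
(* Here [M k *m xsol = N k *m xsol + b] for each [k], and the [E k] sum to the identity. *)
have stepB x : multisplitting_step M N E b x - xsol
    = (\sum_k E k *m (invmx (M k) *m N k)) *m (x - xsol).
  rewrite /multisplitting_step -[X in _ - X]mul1mx -E1 !mulmx_suml -sumrB.
  apply: eq_bigr => k _; rewrite -mulmxBr -!mulmxA; congr (_ *m _).
  rewrite -[X in _ - X](mulKmx (Mu k)) -mulmxBr; congr (_ *m _).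
  have -> : b = (M k - N k) *m xsol by rewrite -AMN mulKVmx.
  by rewrite mulmxBl mulmxBr addrA addrAC addrK.
(* For [n = 0] all vectors coincide, and [E k] says nothing about [beta k]; otherwise its entry at
   [0 0] is [beta k]. *)
case: n => [|n] in A M N E b A_unit splitA cond xsol x0 AMN Mu Ediag E1 stepB *.
  rewrite (_ : multisplitting_iterate _ _ _ _ _ = fun=> xsol).
    exact: (@cvg_cst 'cV[R[i]^o]_0).
  by apply/funext => i; rewrite [LHS]flatmx0 [RHS]flatmx0.
have betaP beta : (forall k, E k = (beta k)%:M) ->
    (forall k, 0 <= beta k) /\ \sum_k beta k = 1.
  move=> Ebeta; split=> [k|].
    by have [_ /(_ 0)] := Ediag k; rewrite Ebeta mxE eqxx.
  have := congr1 (fun X : 'M[R[i]]_(n.+1) => X 0 0) E1.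
  rewrite summxE mxE eqxx mulr1n => <-.
  by apply: eq_bigr => k _; rewrite Ebeta mxE eqxx mulr1n.
case: cond => -[beta betaE].
- have [|beta_ge0 beta1] := betaP beta; first by move=> k; have [] := betaE k.
  (* The similarity is by [A], with [Y] the convex combination of the [N k *m invmx (M k)]. *)
  apply: (cvg_iter_similar_contractive x0 A_unit _ _ stepB).
    apply: (contractive_convex beta_ge0 beta1) => k.
    have [_ _ [Xh Xpos]] := betaE k.
    exact: contractive_mulmx_invmx Xh Xpos.
  rewrite mulmx_sumr mulmx_suml; apply: eq_bigr => k _.
  have [-> _ _] := betaE k.
  rewrite mul_scalar_mx -scalemxAr -scalemxAl; congr (_ *: _).
  (* Both sides reduce to [N k - N k *m invmx (M k) *m N k]. *)
  rewrite (AMN k) mulmxBl mulmxBr mulKVmx // mulmxA.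
  by rewrite -[N k *m _ *m M k]mulmxA mulVmx // mulmx1.
- have [|beta_ge0 beta1] := betaP beta; first by move=> k; have [] := betaE k.
  (* The iteration matrix itself contracts, so [P] is the identity. *)
  apply: (cvg_iter_similar_contractive x0 (unitmx1 _ _) _ _ stepB).
    apply: (contractive_convex (X := fun k => invmx (M k) *m N k)
              beta_ge0 beta1) => k.
    by have [_ /contractive_spectral_norm] := betaE k.
  rewrite mul1mx mulmx1; apply: eq_bigr => k _.
  by have [-> _] := betaE k; rewrite mul_scalar_mx.
Qed.
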